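(* Let $\beta>-1$ and let $m\ge n\ge0$ be integers. Write $Z_{m,n}$ for $Z^{(\beta)}_{m,n}(z_1,z_2)$. Then $$\delta_{z_2}Z_{m,n}=-z_2Z_{m,n-1},\qquad \delta_{z_2}Z_{m,n}=nZ_{m,n}-(\beta+m)Z_{m-1,n-1},$$ $$\delta_{z_1}Z_{m,n}=(m-n)Z_{m,n}-z_2Z_{m,n-1},\qquad \delta_{z_1}Z_{m,n}=mZ_{m,n}-(m+\beta)Z_{m-1,n-1},$$ $$(\delta_{z_1}-\delta_{z_2})Z_{m,n}=(m-n)Z_{m,n},\qquad (n\delta_{z_1}-m\delta_{z_2})Z_{m,n}=(m-n)(m+\beta)Z_{m-1,n-1}.$$ Moreover they have the operational representation $$Z_{m,n}=\frac{(-1)^n}{n!}\,z_1^{-\beta}\exp(-\partial_{z_1}\partial_{z_2})\,z_1^{\beta+m}z_2^n$$ and the Rodrigues type representation $$Z_{m,n}=\frac1{n!}z_1^{-\beta}e^{z_1z_2}\partial_{z_1}^n\big(z_1^{m+\beta}e^{-z_1z_2}\big)=\frac{(-1)^m}{n!}(z_1z_2)^{-\beta}e^{z_1z_2}\partial_{z_1}^n\big((z_1z_2)^\beta\,\partial_{z_2}^m(e^{-z_1z_2})\big).$$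
   Context: For $\beta>-1$ and integers $m\ge n\ge0$, $$Z^{(\beta)}_{m,n}(z_1,z_2)=\frac1{n!}\sum_{k=0}^n\binom nk\frac{(\beta+1)_m}{(\beta+1)_{m-k}}(-1)^{n-k}z_1^{m-k}z_2^{n-k},$$ and $Z^{(\beta)}_{m,n}(z_1,z_2)=Z^{(\beta)}_{n,m}(z_2,z_1)$ for $m<n$; terms with a negative index are $0$. Here $(a)_k=a(a+1)\cdots(a+k-1)$, $\partial_{z_j}=\partial/\partial z_j$, $\delta_{z_j}=z_j\partial_{z_j}$, and $z_1,z_2$ are treated as independent variables. $\exp(-\partial_{z_1}\partial_{z_2})=\sum_{k\ge0}\frac{(-1)^k}{k!}\partial_{z_1}^k\partial_{z_2}^k$ (the sum terminates on functions polynomial in $z_2$). In formulas with non-integer powers, $z_j\notin(-\infty,0]$, powers are principal and $(z_1z_2)^\beta$ means $z_1^\beta z_2^\beta$. *)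

(* Defs.v *)
From HB Require Import structures.
From mathcomp Require Import all_boot all_order all_algebra.
From mathcomp Require Import complex.
From mathcomp Require Import all_classical all_reals all_analysis.
Set Implicit Arguments.
Unset Strict Implicit.
Unset Printing Implicit Defensive.
Import Order.TTheory GRing.Theory Num.Theory numFieldNormedType.Exports.
Local Open Scope classical_set_scope.
Local Open Scope ring_scope.
Local Open Scope complex_scope.

Definition Cexp (R : realType) (z : R[i]) : R[i] :=
  (expR (complex.Re z))%:C * (cos (complex.Im z) +i* sin (complex.Im z)).

(* Principal argument, with values in ]-pi, pi] when z != 0. *)
Definition Carg (R : realType) (z : R[i]) : R :=
  let t := acos (complex.Re z / complex.Re `|z|) in
  if 0 <= complex.Im z then t else - t.

Definition Clog (R : realType) (z : R[i]) : R[i] :=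
  ln (complex.Re `|z|) +i* Carg z.

(* Only meaningful for z != 0. *)
Definition Cpow (R : realType) (z a : R[i]) : R[i] := Cexp (a * Clog z).

(* On R[i], z <= 0 is the partial order: it says that z is real and
   nonpositive, i.e. that z lies on the cut (-oo, 0]. *)
Definition off_cut (R : realType) (z : R[i]) : bool := ~~ (z <= 0).

Lemma off_cutE (R : realType) (z : R[i]) :
  off_cut z = ~~ ((complex.Im z == 0) && (complex.Re z <= 0)).
Proof. by case: z => x y; rewrite /off_cut lecE /= eq_sym. Qed.

Lemma ClogK (R : realType) (z : R[i]) : z != 0 -> Cexp (Clog z) = z.
Proof.
case: z => x y z0; rewrite /Clog /Carg /Cexp /=.
set r := Num.sqrt _.
have xy0 : 0 < x ^+ 2 + y ^+ 2.
  rewrite lt_neqAle addr_ge0 ?sqr_ge0// andbT eq_sym paddr_eq0 ?sqr_ge0//.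
  rewrite !sqrf_eq0; apply: contra z0 => /andP[/eqP-> /eqP->] //.
have r0 : 0 < r by rewrite sqrtr_gt0.
have r2 : r ^+ 2 = x ^+ 2 + y ^+ 2 by rewrite sqr_sqrtr// ltW.
have xr : -1 <= x / r <= 1.
  rewrite ler_pdivlMr// mulN1r ler_pdivrMr// mul1r -ler_norml.
  have := sqr_ge0 y; rewrite -(lerDl (x ^+ 2)) -r2 -(real_normK (num_real x)).
  by rewrite ler_sqr ?nnegrE// ltW.
have cE : cos (acos (x / r)) = x / r by apply: acosK; rewrite in_itv.
have sE : sin (acos (x / r)) = `|y| / r.
  rewrite sin_acos// expr_div_n.
  have -> : 1 - x ^+ 2 / r ^+ 2 = (y / r) ^+ 2.
    by rewrite -[1](@divff _ (r ^+ 2)) ?expf_neq0 ?gt_eqF// -mulrBl {1}r2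
       addrAC subrr add0r expr_div_n.
  by rewrite sqrtr_sqr normrM normfV (gtr0_norm r0).
rewrite lnK ?posrE//.
have rK a : r * (a / r) = a by rewrite mulrC divfK ?gt_eqF.
apply/eqP; rewrite eq_complex /=; case: ifP => [y0|/negbT].
  by rewrite cE sE ger0_norm// !mul0r subr0 addr0 !rK !eqxx.
rewrite -ltNge => y0.
by rewrite cosN sinN cE sE ltr0_norm// mulNr opprK !mul0r subr0 addr0 !rK !eqxx.
Qed.

(* R[i]^o is R[i] seen as a normed space over itself, so these are complex
   derivatives. *)
Definition Cdiff (R : realType) (f : R[i] -> R[i]) (z : R[i]) : Prop :=
  derivable (f : R[i]^o -> R[i]^o) z 1.

Definition Cderive (R : realType) (f : R[i] -> R[i]) (z : R[i]) : R[i] :=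
  derive1 (f : R[i] -> R[i]^o) z.

Definition pd1 (R : realType) (F : R[i] -> R[i] -> R[i]) (z1 z2 : R[i]) :=
  Cderive (fun w => F w z2) z1.

Definition pd2 (R : realType) (F : R[i] -> R[i] -> R[i]) (z1 z2 : R[i]) :=
  Cderive (fun w => F z1 w) z2.

(* The operators above are total and take arbitrary values where a derivative
   does not exist; the following predicates say that the first k iterated
   derivatives do exist. *)
Definition pd1_exists (R : realType) (k : nat) (F : R[i] -> R[i] -> R[i])
    (z1 z2 : R[i]) : Prop :=
  forall i : nat, (i < k)%N -> Cdiff (fun w => iter i (@pd1 R) F w z2) z1.

Definition pd2_exists (R : realType) (k : nat) (F : R[i] -> R[i] -> R[i])
    (z1 z2 : R[i]) : Prop :=
  forall i : nat, (i < k)%N -> Cdiff (fun w => iter i (@pd2 R) F z1 w) z2.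

Definition delta1 (R : realType) (F : R[i] -> R[i] -> R[i]) (z1 z2 : R[i]) :=
  z1 * pd1 F z1 z2.

Definition delta2 (R : realType) (F : R[i] -> R[i] -> R[i]) (z1 z2 : R[i]) :=
  z2 * pd2 F z1 z2.

Definition expNd12_term (R : realType) (F : R[i] -> R[i] -> R[i])
    (z1 z2 : R[i]) (k : nat) : R[i]^o :=
  (-1) ^+ k / k`!%:R * iter k (@pd1 R) (iter k (@pd2 R) F) z1 z2.

(* exp(- d/dz1 d/dz2) *)
Definition expNd12 (R : realType) (F : R[i] -> R[i] -> R[i])
    (z1 z2 : R[i]) : R[i] :=
  limn (series (expNd12_term F z1 z2)).

Definition expNd12_exists (R : realType) (F : R[i] -> R[i] -> R[i])
    (z1 z2 : R[i]) : Prop :=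
  (forall k : nat,
     pd2_exists k F z1 z2 /\ pd1_exists k (iter k (@pd2 R) F) z1 z2) /\
  cvgn (series (expNd12_term F z1 z2)).

Definition poch (R : realType) (a : R) (k : nat) : R :=
  \prod_(i < k) (a + i%:R).

(* The explicit formula, used for n <= m only. *)
Definition Zsum (R : realType) (beta : R) (m n : nat) (z1 z2 : R[i]) : R[i] :=
  (n`!%:R)^-1 *
  \sum_(k < n.+1)
    'C(n, k)%:R * (poch (beta + 1) m / poch (beta + 1) (m - k))%:C
    * (-1) ^+ (n - k) * z1 ^+ (m - k) * z2 ^+ (n - k).

Definition Z (R : realType) (beta : R) (m n : int) (z1 z2 : R[i]) : R[i] :=
  match m, n with
  | Posz m, Posz n =>
      if (n <= m)%N then Zsum beta m n z1 z2 else Zsum beta n m z2 z1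
  | _, _ => 0
  end.

(* Main.v *)
Require Import Defs.
From HB Require Import structures.
From mathcomp Require Import all_boot all_order all_algebra.
From mathcomp Require Import complex.
From mathcomp Require Import all_classical all_reals all_analysis.
From mathcomp Require Import ring lra.
Set Implicit Arguments.
Unset Strict Implicit.
Unset Printing Implicit Defensive.
Import Order.TTheory GRing.Theory Num.Theory numFieldNormedType.Exports.
Local Open Scope classical_set_scope.
Local Open Scope ring_scope.
Local Open Scope complex_scope.

(** Write [Z_(m,n) = 1/n! * sum_k t_k], where
[t_k = C(n,k) (beta+m)(beta+m-1)...(beta+m-k+1) (-1)^(n-k) z1^(m-k) z2^(n-k)]
([poch_ratio] rewrites the quotient of Pochhammer symbols as this falling
factorial).

The differential relations. Each [t_k] is a monomial, hence an eigenvector of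
[delta1] and [delta2] for the eigenvalues [m-k] and [n-k]. So all relations are
linear combinations of two facts about weighted sums of the [t_k]:
[1/n! * sum_k (n-k) t_k = - z2 Z_(m,n-1)] ([sum_subn_Zterm]) and
[1/n! * sum_k k t_k = (beta+m) Z_(m-1,n-1)] ([sum_ord_Zterm]), both consequences
of the absorption identities for binomial coefficients.

The representations. The falling factorial is the coefficient that appears when
[z1^(beta+m)] is differentiated [k] times. In the operational formula the [k]-th
term of [exp(-d1 d2)] applied to [z1^(beta+m) z2^n] therefore is a multiple of
[z1^beta t_k] by a constant that does not depend on [k], and in the Rodrigues
formulas [t_k] is, up to [z1^beta e^(-z1 z2)], the [k]-th term of Leibniz'
formula for the [n]-th derivative of [z1^(beta+m) e^(-z1 z2)].

The analytic input is that principal powers are complex differentiable on the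
slit plane with the expected derivative ([is_derive_Cpow]). The exponential is
differentiable by a quadratic estimate of its Taylor remainder
([norm_CexpB_le]). The principal logarithm is a right inverse of it, and a
continuous right inverse of a function with nonzero derivative is differentiable
([is_derive_right_inverse]); continuity of the argument is seen from
[Carg z = 2 atan (Im z / (|z| + Re z))] ([Carg_off_cut]). Iterated derivatives
on the slit plane, which is open, are then identified by exhibiting sequences of
functions in which each is the derivative of the preceding one
([iter_Cderive]). *)

(** * Complex differentiability over a numeric field *)

(** A derivative can be read off a factorization of the increment
[f w - f z] through [w - z] whose other factor is continuous at [z]: this
form of differentiability composes and inverts without division. *)
Lemma slope_is_derive (K : numFieldType) (f phi : K^o -> K^o) (z : K^o) :
    (\forall w \near z, f w = f z + phi w * (w - z)) ->
    {for z, continuous phi} ->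
  is_derive z 1 f (phi z).
Proof.
move=> fE phiz; pose g w := f z + phi w * (w - z).
apply: (@near_eq_is_derive _ _ _ g).
  by near do symmetry.
suff Hf : h^-1 *: ((g \o shift z) (h *: 1) - g z) @[h --> 0^'] --> phi z.
  by apply: DeriveDef; [exact: cvgP Hf | exact: cvg_lim Hf].
have phi0 : (phi \o shift z) y @[y --> 0^'] --> phi z.
  exact/continuous_withinNshiftx.
apply: cvg_trans phi0; apply: near_eq_cvg; near=> h.
have h0 : h != 0 by near: h; exact: nbhs_dnbhs_neq.
rewrite /g/= [h *: 1]mulr1 subrr mulr0 addr0 addrK [f z + _]addrC addrK.
by rewrite [RHS]mulrC mulfK.
Unshelve. all: by end_near. Qed.

Lemma is_derive_slope (K : numFieldType) (f : K^o -> K^o) (z d : K^o) :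
  is_derive z 1 f d ->
  exists phi : K^o -> K^o, [/\ forall w, f w - f z = phi w * (w - z),
    {for z, continuous phi} & phi z = d].
Proof.
move=> fz; exists (fun w => if w == z then d else (f w - f z) / (w - z)).
split.
- move=> w; case: eqP => [->|/eqP]; first by rewrite !subrr mulr0.
  by rewrite -subr_eq0 => /divfK->.
- apply/continuous_withinNshiftx; rewrite eqxx /=.
  pose g1 h := (h^-1 *: ((f \o shift z) (h%:A) - f z)).
  have F1 : g1 @ 0^' --> d by case: fz => H1 <-.
  apply: cvg_trans F1; apply: near_eq_cvg; rewrite /g1 !fctE.
  near=> i.
  have i0 : i != 0 by near: i; exact: nbhs_dnbhs_neq.
  rewrite ifN; first by rewrite addrK mulrC /= [_%:A]mulr1.
  by rewrite -subr_eq0 addrK.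
- by rewrite eqxx.
Unshelve. all: by end_near. Qed.

(** If [f w - f (g z) = phi w * (w - g z)], then substituting [g w] for [w]
gives [w - z = phi (g w) * (g w - g z)], so the slope of [g] is
[(phi (g w))^-1]; continuity of [g] lets one pass to the limit. *)
Lemma is_derive_right_inverse (K : numFieldType) (f g : K^o -> K^o)
    (z d : K^o) :
    (\forall w \near z, f (g w) = w) -> {for z, continuous g} ->
    is_derive (g z) 1 f d -> d != 0 ->
  is_derive z 1 g d^-1.
Proof.
move=> gK gz /is_derive_slope[phi [fE phic <-]] d0.
have phig : {for z, continuous (phi \o g)}.
  by apply: continuous_comp => /=; [exact: gz|exact: phic].
apply: (@slope_is_derive _ _ (fun w => (phi (g w))^-1)); last first.
  by apply: continuousV => //; exact: phig.
(* Near z the slope of f stays away from 0, since it tends to d. *)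
have phin0 : \forall w \near z, phi (g w) != 0.
  exact: (cvgr_neq0 _ phig).
near=> w; have wn0 : phi (g w) != 0 by near: w.
have gwK : f (g w) = w by near: w.
have -> : w - z = f (g w) - f (g z) by rewrite gwK (nbhs_singleton gK).
by rewrite fE mulKf// addrC subrK.
Unshelve. all: by end_near. Qed.

Lemma is_derive_compK (K : numFieldType) (f g : K^o -> K^o) (z a b : K^o) :
  is_derive (g z) 1 f a -> is_derive z 1 g b ->
  is_derive z 1 (f \o g) (a * b).
Proof.
move=> /is_derive_slope[phi [fE phic <-]] gD.
have /is_derive_slope[psi [gE psic <-]] := gD.
have gc : {for z, continuous g}.
  by apply: differentiable_continuous; apply/derivable1_diffP; case: gD.
apply: (@slope_is_derive _ _ (fun w => phi (g w) * psi w)); last first.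
  by apply: (@continuousM K K^o (phi \o g) psi z);
    [exact: continuous_comp | exact: psic].
by apply: filterE => w /=; rewrite -mulrA -gE -fE addrC subrK.
Qed.

Lemma is_derive_quadratic (K : numFieldType) (f : K^o -> K^o) (z d r c : K) :
    0 < r -> 0 < c ->
    (forall h, `|h| <= r -> `|f (h + z) - f z - d * h| <= c * `|h| ^+ 2) ->
  is_derive (z : K^o) 1 f d.
Proof.
move=> r0 c0 fh.
have H : h^-1 *: ((f \o shift (z : K^o)) (h *: 1) - f z) @[h --> (0 : K^o)^']
    --> (d : K^o).
  apply/cvgrPdist_le => e e0; near=> h.
  have h0 : h != 0 by near: h; exact: nbhs_dnbhs_neq.
  have hr : `|h| <= r by near: h; exact: dnbhs0_le.
  have he : `|h| <= e / c by near: h; apply: dnbhs0_le; rewrite divr_gt0.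
  have hn0 : 0 < `|h| by rewrite normr_gt0.
  have -> : d - h^-1 *: ((f \o shift z) (h *: 1) - f z) =
      - (h^-1 * (f (h + z) - f z - d * h)).
    have -> (u : K) : h^-1 *: (u : K^o) = h^-1 * u by [].
    by rewrite [h *: 1]mulr1 /=; field.
  rewrite normrN normrM normfV ler_pdivrMl// (le_trans (fh _ hr))//.
  by rewrite expr2 mulrCA ler_wpM2l// mulrC -ler_pdivlMr.
by apply: DeriveDef; [exact: cvgP H | exact: cvg_lim H].
Unshelve. all: by end_near. Qed.

Lemma near_norm_le (K : numFieldType) (z e : K) :
  0 < e -> \forall w \near (z : K^o), `|z - w| <= e.
Proof.
by move=> e0; near=> w; apply: ltW; near: w; exact: (@nbhsx_ballx _ K^o).
Unshelve. all: by end_near. Qed.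

Section derivation_rules.
Variable K : numFieldType.
Implicit Types (f g : K^o -> K^o) (x c : K^o).

Lemma is_derive_mulcl c f x d :
  is_derive x 1 f d -> is_derive x 1 (fun w => c * f w) (c * d).
Proof. exact: is_deriveZ. Qed.

Lemma is_derive_mulcr c f x d :
  is_derive x 1 f d -> is_derive x 1 (fun w => f w * c) (d * c).
Proof.
move=> fD; rewrite mulrC (_ : (fun w => _) = (fun w => c * f w)).
  exact: is_derive_mulcl.
by apply/funext => w; rewrite mulrC.
Qed.

Lemma is_derive_mul f g x df dg :
  is_derive x 1 f df -> is_derive x 1 g dg ->
  is_derive x 1 (fun w => f w * g w) (df * g x + f x * dg).
Proof.
move=> fD gD; have H := is_deriveM fD gD; apply: (is_derive_eq H).
by rewrite addrC; congr (_ + _); exact: mulrC.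
Qed.

Lemma is_derive_bigsum n (h : 'I_n -> K^o -> K^o) (dh : 'I_n -> K^o) x :
  (forall i, is_derive x 1 (h i) (dh i)) ->
  is_derive x 1 (fun w => \sum_(i < n) h i w) (\sum_(i < n) dh i).
Proof.
move=> hD; rewrite (_ : (fun w => _) = \sum_(i < n) h i).
  exact: is_derive_sum.
by apply/funext => w; rewrite fct_sumE.
Qed.

Lemma is_derive_expr n x : is_derive x 1 (fun w => w ^+ n) (n%:R * x ^+ n.-1).
Proof.
apply: DeriveDef; first exact: exprn_derivable.
by rewrite exp_derive [_%:A]mulr1.
Qed.

End derivation_rules.

(** * The complex exponential, logarithm and powers *)

Section complex_exponential.
Variable R : realType.
Implicit Types (z w : R[i]) (x y : R).

Lemma CexpD z w : Cexp (z + w) = Cexp z * Cexp w.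
Proof.
case: z w => [a b] [c d]; rewrite /Cexp /= expRD cosD sinD.
by apply/eqP; rewrite eq_complex /=; apply/andP; split; apply/eqP; ring.
Qed.

Lemma Cexp0 : Cexp (0 : R[i]) = 1.
Proof. by rewrite /Cexp /= expR0 cos0 sin0 mul1r. Qed.

Lemma CexpN_mulr z : Cexp (- z) * Cexp z = 1.
Proof. by rewrite -CexpD addNr Cexp0. Qed.

Lemma Cexp_neq0 z : Cexp z != 0.
Proof.
apply/eqP => z0; have := CexpN_mulr z; rewrite z0 mulr0 => /eqP.
by rewrite eq_sym oner_eq0.
Qed.

Lemma CexpMn z n : Cexp (n%:R * z) = Cexp z ^+ n.
Proof.
elim: n => [|n IHn]; first by rewrite mul0r Cexp0 expr0.
by rewrite mulrSr mulrDl mul1r CexpD IHn exprSr.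
Qed.

Lemma norm_sin_le x : `|sin x| <= `|x|.
Proof.
have [c] : exists c, sin x = cos c * x.
  have [x0|x0] := leP 0 x.
    have [|c _] := @MVT_segment R sin cos 0 x x0.
      by apply: continuous_subspaceT => u; exact: continuous_sin.
    by rewrite sin0 !subr0 => ?; exists c.
  have [|c _] := @MVT_segment R sin cos x 0 (ltW x0).
    by apply: continuous_subspaceT => u; exact: continuous_sin.
  by rewrite sin0 !sub0r mulrN => /oppr_inj ?; exists c.
by move=> ->; rewrite normrM ler_piMl// cos_max.
Qed.

Lemma norm_cosB1_le x : `|cos x - 1| <= x ^+ 2.
Proof.
have -> : cos x - 1 = - (2 * sin (x / 2) ^+ 2).
  have {1}-> : x = (x / 2) *+ 2 by rewrite -mulr_natr divfK.
  by rewrite cos_mulr2n cos2sin2; ring.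
rewrite normrN normrM normrX [`|2|]ger0_norm// -[x ^+ 2]real_normK ?num_real//.
have := norm_sin_le (x / 2); have := normr_ge0 (sin (x / 2)).
rewrite normrM [`|_^-1|]ger0_norm//.
by nra.
Qed.

Lemma norm_sinBid_le x : `|x| <= 1 -> `|sin x - x| <= x ^+ 2.
Proof.
move=> x1; have [c cx ->] : exists2 c, `|c| <= `|x| &
    sin x - x = (cos c - 1) * x.
  have [x0|x0] := leP 0 x.
    have [|c] := @MVT_segment R sin cos 0 x x0.
      by apply: continuous_subspaceT => u; exact: continuous_sin.
    rewrite in_itv/= sin0 !subr0 => /andP[c0 cx] ->; exists c; last by ring.
    by rewrite !ger0_norm.
  have [|c] := @MVT_segment R sin cos x 0 (ltW x0).
    by apply: continuous_subspaceT => u; exact: continuous_sin.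
  rewrite in_itv/= sin0 !sub0r mulrN => /andP[xc c0] /oppr_inj ->.
  exists c; last by ring.
  by rewrite !ler0_norm ?lerN2// ltW.
rewrite normrM -[x ^+ 2]real_normK ?num_real//.
have := norm_cosB1_le c; rewrite -[c ^+ 2]real_normK ?num_real//.
have := normr_ge0 c; have := normr_ge0 (cos c - 1).
move: `|c| `|cos c - 1| `|x| x1 cx => u v y y1 uy v0 u0 vu.
have y0 : 0 <= y by exact: le_trans u0 uy.
have vy : v <= y by apply: le_trans vu _; rewrite -[leRHS]mul1r; nra.
by rewrite expr2 ler_wpM2r.
Qed.

(** The upper bound comes from [1 - x <= expR (- x)], that is
[expR x * (1 - x) <= 1]. *)
Lemma norm_expRB1_le x : `|x| <= 2^-1 -> `|expR x - 1 - x| <= 2 * x ^+ 2.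
Proof.
rewrite ler_norml => /andP[x1 x2].
have := expR_ge1Dx x; have := expR_ge1Dx (- x); have := expR_gt0 x.
have := expRxMexpNx_1 x; set e := expR x; set e' := expR (- x) => ee' e0 e'x ex.
rewrite ger0_norm; last by rewrite -addrA -opprD subr_ge0.
have : e * (1 - x) <= 1 by rewrite -[leRHS]ee' ler_pM2l.
by nra.
Qed.

End complex_exponential.

Section complex_analysis.
Variable R : realType.
Implicit Types (z w : R[i]) (x y : R).

Lemma normc_le_ReIm z : `|z| <= (`|complex.Re z| + `|complex.Im z|)%:C.
Proof.
rewrite [in leLHS](complexE z) rmorphD/=.
apply: (le_trans (ler_normD _ _)).
rewrite normrM !normc_def /= !expr0n/= expr1n !addr0 add0r sqrtr1 mul1r.
by rewrite !sqrtr_sqr.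
Qed.

Lemma normc_ReK z : (complex.Re `|z|)%:C = `|z|.
Proof. by rewrite RRe_real// normr_real. Qed.

Lemma sqr_normc_Re z :
  complex.Re `|z| ^+ 2 = complex.Re z ^+ 2 + complex.Im z ^+ 2.
Proof. by rewrite normc_def/= sqr_sqrtr// addr_ge0// sqr_ge0. Qed.

Lemma normc_Re_ge0 z : 0 <= complex.Re `|z|.
Proof. by rewrite normc_def/= sqrtr_ge0. Qed.

(** The second-order Taylor estimate on which the differentiability of the
complex exponential rests. It is derived from the real estimates for [expR],
[cos] and [sin]: the real part of the remainder is
[(expR x - 1 - x) + expR x * (cos y - 1)] and its imaginary part is
[(expR x - 1) * sin y + (sin y - y)]. *)
Lemma norm_CexpB_le z : `|z| <= 2^-1 -> `|Cexp z - 1 - z| <= 4 * `|z| ^+ 2.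
Proof.
move=> z2; have {z2} : complex.Re `|z| <= 2^-1.
  by rewrite -lecR normc_ReK (le_trans z2)// fmorphV rmorph_nat.
have -> : 4 * `|z| ^+ 2 = (4 * complex.Re `|z| ^+ 2)%:C.
  by rewrite rmorphM rmorphXn rmorph_nat/= normc_ReK.
move=> z2; apply: (le_trans (normc_le_ReIm _)); rewrite lecR.
move: z2 (sqr_normc_Re z) (normc_Re_ge0 z); move: (complex.Re `|z|) => r.
case: z => x y /= r2 rE r0; rewrite !subr0.
have xr : `|x| <= r.
  by rewrite -ler_sqr ?nnegrE// real_normK ?num_real// rE lerDl sqr_ge0.
have yr : `|y| <= r.
  by rewrite -ler_sqr ?nnegrE// real_normK ?num_real// rE lerDr sqr_ge0.
have x2 := le_trans xr r2; have y1 : `|y| <= 1 by lra.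
have ex := norm_expRB1_le x2.
have cy := norm_cosB1_le y; have sy := norm_sinBid_le y1.
have sy1 := norm_sin_le y.
have x2E := real_normK (num_real x); have y2E := real_normK (num_real y).
have e1 : `|expR x - 1| <= 2 * `|x|.
  have := ler_normD (expR x - 1 - x) x; rewrite subrK.
  by have := normr_ge0 x; nra.
have e2 : `|expR x| <= 2.
  by have := ler_normD (expR x - 1) 1; rewrite subrK normr1; lra.
have reb : `|expR x * cos y - 1 - x| <= 2 * x ^+ 2 + 2 * y ^+ 2.
  have -> : expR x * cos y - 1 - x =
      (expR x - 1 - x) + expR x * (cos y - 1) by ring.
  by rewrite (le_trans (ler_normD _ _))// lerD// normrM ler_pM.
have imb : `|expR x * sin y - y| <= x ^+ 2 + 2 * y ^+ 2.
  have -> : expR x * sin y - y = (expR x - 1) * sin y + (sin y - y) by ring.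
  have : `|(expR x - 1) * sin y| <= 2 * `|x| * `|y| by rewrite normrM ler_pM.
  have := ler_normD ((expR x - 1) * sin y) (sin y - y).
  have := sqr_ge0 (`|x| - `|y|); nra.
rewrite !mul0r addr0 ?subr0 ?add0r; nra.
Qed.

Lemma is_derive_Cexp z :
  is_derive (z : R[i]^o) 1 (@Cexp R : R[i]^o -> R[i]^o) (Cexp z).
Proof.
apply: (@is_derive_quadratic _ _ _ _ 2^-1 (4 * `|Cexp z|)) => [||h h2].
- by rewrite invr_gt0.
- by rewrite mulr_gt0// normr_gt0 Cexp_neq0.
have -> : Cexp (h + z) - Cexp z - Cexp z * h = Cexp z * (Cexp h - 1 - h).
  by rewrite CexpD; ring.
by rewrite normrM mulrAC [leRHS]mulrC ler_wpM2l// norm_CexpB_le.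
Qed.

Lemma cvg_complex (T : Type) (F : set_system T) {FF : Filter F}
    (u v : T -> R) (a b : R) :
  u @ F --> a -> v @ F --> b ->
  (fun t => u t +i* v t : R[i]^o) @ F --> (a +i* b : R[i]^o).
Proof.
move=> ua vb; apply/cvgrPdist_le => e e0.
have eE : e = (complex.Re e)%:C by rewrite RRe_real// gtr0_real.
have e'0 : 0 < complex.Re e / 2 by rewrite divr_gt0// -ltcR -eE.
near=> t; apply: (le_trans (normc_le_ReIm _)) => /=.
rewrite eE lecR [leRHS]splitr lerD//; near: t.
- by move/cvgrPdist_le : ua; apply.
- by move/cvgrPdist_le : vb; apply.
Unshelve. all: by end_near. Qed.

Lemma continuous_Re : continuous (fun z : R[i]^o => complex.Re z).
Proof.
move=> z; apply/(@cvgrPdist_le _ R^o _ _ (nbhs_filter (z : R[i]^o))) => e e0.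
have : 0 < e%:C by rewrite ltcR.
move=> /(@near_norm_le _ z); apply: filterS => w /= zw.
by rewrite -lecR (le_trans _ zw)// -raddfB normc_ge_Re.
Qed.

Lemma continuous_Im : continuous (fun z : R[i]^o => complex.Im z).
Proof.
move=> z; apply/(@cvgrPdist_le _ R^o _ _ (nbhs_filter (z : R[i]^o))) => e e0.
have : 0 < e%:C by rewrite ltcR.
move=> /(@near_norm_le _ z); apply: filterS => w /= zw.
rewrite -lecR (le_trans _ zw)// -raddfB -normrN -ReiNIm.
rewrite (le_trans (normc_ge_Re _))//.
by rewrite normrM [X in _ * X]normc_def/= expr0n expr1n add0r sqrtr1 mulr1.
Qed.

Lemma continuous_normc : continuous (fun z : R[i]^o => complex.Re `|z|).
Proof.
move=> z; apply/(@cvgrPdist_le _ R^o _ _ (nbhs_filter (z : R[i]^o))) => e e0.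
have : 0 < e%:C by rewrite ltcR.
move=> /(@near_norm_le _ z); apply: filterS => w /= zw.
have := ler_dist_dist (z : R[i]) w; rewrite -[`|z|]normc_ReK.
rewrite -[`|w|]normc_ReK -rmorphB/= [in leLHS]normc_def/= expr0n addr0.
by rewrite sqrtr_sqr => zw'; rewrite -lecR (le_trans zw').
Qed.

(** The function [|z| + Re z] is nonnegative and vanishes exactly on the cut;
as it is continuous, the slit plane is open. *)
Lemma off_cut_normDRe z : off_cut z = (0 < complex.Re `|z| + complex.Re z).
Proof.
rewrite off_cutE; have := sqr_normc_Re z; have := normc_Re_ge0 z.
case: z => x y /=; move: (Num.sqrt _) => r r0 rE; have [y0|y0] /= := eqVneq y 0.
  move: rE; rewrite y0 expr0n addr0 => /eqP; rewrite eqf_sqr => /orP[]/eqP rx.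
    by rewrite rx; rewrite rx in r0; apply/idP/idP; lra.
  by rewrite rx; rewrite rx in r0; apply/idP/idP; lra.
have : 0 < y ^+ 2 by rewrite exprn_even_gt0.
by move=> y2; apply/esym; have [x0|x0] := leP 0 x; nra.
Qed.

Lemma continuous_normDRe :
  continuous (fun z : R[i]^o => complex.Re `|z| + complex.Re z).
Proof.
by move=> z; exact: (continuousD (@continuous_normc z) (@continuous_Re z)).
Qed.

Lemma near_off_cut z : off_cut z -> \forall w \near (z : R[i]^o), off_cut w.
Proof.
rewrite off_cut_normDRe => z0.
have := @continuous_normDRe z.
move=> /cvgr_gt/(_ 0 z0).
by apply: filterS => w; rewrite off_cut_normDRe.
Qed.

Lemma off_cut_neq0 z : off_cut z -> z != 0.
Proof. by apply: contraTneq => ->; rewrite /off_cut lexx. Qed.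

(** Half-angle formula for the argument. Unlike the definition by [acos] and a
test on the sign of the imaginary part, it is a single expression on the whole
slit plane, so that continuity across the positive real axis is immediate. *)
Lemma Carg_off_cut z : off_cut z ->
  Carg z = 2 * atan (complex.Im z / (complex.Re `|z| + complex.Re z)).
Proof.
rewrite off_cut_normDRe => q0; rewrite /Carg.
have := sqr_normc_Re z; have := normc_Re_ge0 z; move: q0.
case: z => x y /=; move: (Num.sqrt _) => r q0 r0 rE.
set t := y / (r + x); set a := atan t.
have r_gt0 : 0 < r.
  by rewrite lt_neqAle r0 andbT; apply/eqP => re; move: rE q0; rewrite -re; nra.
(* With t = y / (r + x), cos (2 * atan t) = (1 - t^2) / (1 + t^2) = x / r. *)
have cE : x / r = cos (2 * a).
  rewrite mulr_natl cos_mulr2n cos_atan exprVn sqr_sqrtr ?addr_ge0 ?sqr_ge0//.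
  have y2 : y ^+ 2 = (r - x) * (r + x) by rewrite -subr_sqr rE; ring.
  rewrite /t exprMn exprVn y2 -mulr_natr.
  by field; apply/and3P; split; apply/eqP; nra.
have a1 := atan_gtNpi2 t; have a2 := atan_ltpi2 t.
have piE : pi = pi / 2 * 2 :> R by rewrite divfK.
have [y0|y0] := leP 0 y.
  have t0 : 0 <= t by rewrite divr_ge0// ltW.
  have a0 : 0 <= a by rewrite -atan0 le_atan.
  rewrite cE cosK// in_itv/= piE.
  by apply/andP; split; rewrite -/a in a1 a2 *; lra.
have t0 : t <= 0 by rewrite ler_pdivrMr// mul0r ltW.
have a0 : a <= 0 by rewrite -atan0 le_atan.
rewrite cE cosKN ?opprK// piE; apply/andP; split; rewrite -/a in a1 a2 *; lra.
Qed.

Lemma continuous_Clog z : off_cut z ->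
  {for (z : R[i]^o), continuous (@Clog R : R[i]^o -> R[i]^o)}.
Proof.
move=> z0.
have z_gt0 : 0 < complex.Re `|z|.
  by rewrite -ltcR normc_ReK normr_gt0 off_cut_neq0.
have q_gt0 := z0; rewrite off_cut_normDRe in q_gt0.
apply: (@cvg_complex _ _ (nbhs_filter (z : R[i]^o))).
  exact: (continuous_comp (@continuous_normc z) (continuous_ln z_gt0)).
rewrite (Carg_off_cut z0).
pose q (w : R[i]^o) := complex.Re `|w| + complex.Re w.
have qV := @continuousV _ _ q z (lt0r_neq0 q_gt0) (@continuous_normDRe z).
have tc := continuousM (@continuous_Im z) qV.
have ac := continuous_comp tc (@continuous_atan R _).
have := continuousM (@cst_continuous (R[i]^o) R 2 z) ac.
apply: cvg_trans; apply: near_eq_cvg.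
by apply: filterS (near_off_cut z0) => w; move=> /Carg_off_cut.
Qed.

(** [Clog] is a continuous right inverse of [Cexp] on the slit plane. *)
Lemma is_derive_Clog z : off_cut z ->
  is_derive (z : R[i]^o) 1 (@Clog R : R[i]^o -> R[i]^o) z^-1.
Proof.
move=> z0; have zn0 := off_cut_neq0 z0.
apply: (@is_derive_right_inverse _ (@Cexp R) (@Clog R)) => //.
- by apply: filterS (near_off_cut z0) => w /off_cut_neq0; exact: ClogK.
- exact: continuous_Clog.
- by rewrite -{2}(ClogK zn0); exact: is_derive_Cexp.
Qed.

End complex_analysis.

Section complex_power.
Variable R : realType.
Implicit Types (z w a b : R[i]).

Lemma CpowD z a b : Cpow z (a + b) = Cpow z a * Cpow z b.
Proof. by rewrite /Cpow mulrDl CexpD. Qed.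

Lemma CpowN_mul z a : Cpow z (- a) * Cpow z a = 1.
Proof. by rewrite -CpowD addNr /Cpow mul0r Cexp0. Qed.

Lemma Cpow_nat z n : z != 0 -> Cpow z n%:R = z ^+ n.
Proof. by move=> z0; rewrite /Cpow CexpMn ClogK. Qed.

Lemma is_derive_Cpow z a : off_cut z ->
  is_derive (z : R[i]^o) 1 (fun w => Cpow w a : R[i]^o) (a * Cpow z (a - 1)).
Proof.
move=> z0; have zn0 := off_cut_neq0 z0.
have logD := is_derive_mulcl a (is_derive_Clog z0).
have := @is_derive_compK _ (@Cexp R) (fun w => a * Clog w) z _ _
  (is_derive_Cexp (a * Clog z)) logD.
move=> H; apply: (is_derive_eq H).
have -> : Cpow z (a - 1) = Cpow z a / z.
  have := CpowD z (a - 1) 1; rewrite subrK => ->.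
  by rewrite (Cpow_nat 1 zn0) expr1 mulfK.
by rewrite mulrCA.
Qed.

End complex_power.

(** * Iterated partial derivatives *)

Section iterated_derivatives.
Variable R : realType.
Implicit Types (U : R[i] -> Prop) (f : nat -> R[i] -> R[i])
  (F : R[i] -> R[i] -> R[i]) (z w : R[i]).

Lemma Cdiff_is_derive (f : R[i] -> R[i]) z d :
  is_derive (z : R[i]^o) 1 (f : R[i]^o -> R[i]^o) d -> Cdiff f z.
Proof. by case. Qed.

Lemma Cderive_val (f : R[i] -> R[i]) z d :
  is_derive (z : R[i]^o) 1 (f : R[i]^o -> R[i]^o) d -> Cderive f z = d.
Proof. by move=> fz; rewrite /Cderive derive1E; exact: derive_val. Qed.

(** Openness, for a predicate on the complex plane. *)
Definition nbhs_stable U :=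
  forall z, U z -> \forall w \near (z : R[i]^o), U w.

(** Iterated derivatives are computed by guessing them all at once: a chain is
a sequence of functions each of which is the derivative of the preceding one
on [U]. *)
Definition derivative_chain U f := forall k z, U z ->
  is_derive (z : R[i]^o) 1 (f k : R[i]^o -> R[i]^o) (f k.+1 z).

(** Derivatives at a point of the open set [U] see [g] only near that point.
This matters for principal powers: [U] is then the slit plane, and on the cut
[Cderive] returns arbitrary values. *)
Lemma iter_Cderive U f (g : R[i] -> R[i]) :
    nbhs_stable U -> derivative_chain U f -> (forall z, U z -> g z = f 0%N z) ->
  forall k z, U z ->
    iter k (@Cderive R) g z = f k z /\ Cdiff (iter k (@Cderive R) g) z.
Proof.
move=> Uo fD g0; suff gk k z : U z -> iter k (@Cderive R) g z = f k z /\
    is_derive (z : R[i]^o) 1 (iter k (@Cderive R) g : R[i]^o -> R[i]^o)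
      (f k.+1 z).
  move=> k z Uz; have [gE gD] := gk k z Uz.
  by split; [exact: gE | exact: Cdiff_is_derive gD].
elim: k z => [|k IHk] z Uz.
  split; first exact: g0.
  apply: near_eq_is_derive (fD 0%N z Uz).
  by apply: filterS (Uo z Uz) => w Uw /=; rewrite g0.
have gE w : U w -> iter k.+1 (@Cderive R) g w = f k.+1 w.
  by move=> /IHk[_ gD]; exact: Cderive_val gD.
split; first exact: gE.
apply: near_eq_is_derive (fD k.+1 z Uz).
by apply: filterS (Uo z Uz) => w Uw; rewrite gE.
Qed.

Lemma iter_pd1E F k z1 z2 :
  iter k (@pd1 R) F z1 z2 = iter k (@Cderive R) (F ^~ z2) z1.
Proof.
elim: k z1 => [//|k IHk] z1 /=.
by congr (Cderive _ z1); apply/funext => w; rewrite IHk.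
Qed.

Lemma iter_pd2E F k z1 z2 :
  iter k (@pd2 R) F z1 z2 = iter k (@Cderive R) (F z1) z2.
Proof.
elim: k z2 => [//|k IHk] z2 /=.
by congr (Cderive _ z2); apply/funext => w; rewrite IHk.
Qed.

Lemma iter_pd1_chain U f F z1 z2 :
    nbhs_stable U -> derivative_chain U f ->
    (forall w, U w -> F w z2 = f 0%N w) -> U z1 ->
  (forall k, iter k (@pd1 R) F z1 z2 = f k z1) /\
  forall k, pd1_exists k F z1 z2.
Proof.
move=> Uo fD F0 Uz; have H := iter_Cderive Uo fD F0.
split=> [k|k i _]; first by rewrite iter_pd1E; have [] := H k z1 Uz.
have -> : (fun w => iter i (@pd1 R) F w z2) = iter i (@Cderive R) (F ^~ z2).
  by apply/funext => w; rewrite iter_pd1E.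
by have [] := H i z1 Uz.
Qed.

Lemma iter_pd2_chain f F z1 :
    derivative_chain (fun=> True) f -> (forall w, F z1 w = f 0%N w) ->
  (forall k z2, iter k (@pd2 R) F z1 z2 = f k z2) /\
  forall k z2, pd2_exists k F z1 z2.
Proof.
move=> fD F0; have T : nbhs_stable (fun=> True) by move=> w _; exact: filterT.
have H := @iter_Cderive (fun=> True) f (F z1) T fD (fun w _ => F0 w).
split=> [k z2|k z2 i _]; first by rewrite iter_pd2E; have [] := H k z2 I.
have -> : (fun w => iter i (@pd2 R) F z1 w) = iter i (@Cderive R) (F z1).
  by apply/funext => w; rewrite iter_pd2E.
by have [] := H i z2 I.
Qed.

End iterated_derivatives.

(** Differentiating a Leibniz sum of order [n] gives the right-hand side, with
[p i j] the product of the [i]-th and [j]-th derivatives of the factors. *)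
Lemma sum_Pascal (K : pzRingType) (p : nat -> nat -> K) n :
  \sum_(k < n.+2) 'C(n.+1, k)%:R * p k (n.+1 - k)%N =
  \sum_(k < n.+1) 'C(n, k)%:R * (p k.+1 (n - k)%N + p k (n - k).+1).
Proof.
under [RHS]eq_bigr do rewrite mulrDr.
rewrite big_split/= big_ord_recl [X in _ = _ + X]big_ord_recl/= !bin0 !subn0 /=.
rewrite [RHS]addrCA; congr (_ + _).
have -> : \sum_(i < n) 'C(n, bump 0 i)%:R * p (bump 0 i) (n - bump 0 i).+1 =
    \sum_(i < n.+1) 'C(n, i.+1)%:R * p i.+1 (n - i)%N.
  rewrite [RHS]big_ord_recr/= bin_small// mul0r addr0.
  by apply: eq_bigr => i _; rewrite subnSK.
rewrite -big_split/=; apply: eq_bigr => i _.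
by rewrite /bump/= add1n binS natrD subSS addrC mulrDl addrC.
Qed.

Section Leibniz.
Variable R : realType.

(** Leibniz' formula for all orders, in the form of a chain. *)
Lemma Leibniz_chain (U : R[i] -> Prop) (u v : nat -> R[i] -> R[i]) :
    derivative_chain U u -> derivative_chain U v ->
  derivative_chain U
    (fun n z => \sum_(k < n.+1) 'C(n, k)%:R * (u k z * v (n - k)%N z)).
Proof.
move=> uD vD n z Uz.
rewrite (sum_Pascal (fun i j => u i z * v j z)).
apply: is_derive_bigsum => k; apply: is_derive_mulcl.
by apply: is_derive_mul; [exact: uD|exact: vD].
Qed.

Lemma scale_chain (U : R[i] -> Prop) (f : nat -> R[i] -> R[i]) c :
  derivative_chain U f -> derivative_chain U (fun n z => c * f n z).
Proof. by move=> fD n z Uz; apply: is_derive_mulcl; exact: fD. Qed.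

End Leibniz.

(** * Falling factorials and the chains of elementary functions *)

Section falling_factorial.

Definition falling (K : pzRingType) (a : K) k : K := \prod_(i < k) (a - i%:R).

Lemma fallingS (K : pzRingType) (a : K) k :
  falling a k.+1 = falling a k * (a - k%:R).
Proof. by rewrite /falling big_ord_recr. Qed.

Lemma falling_recl (K : pzRingType) (a : K) k :
  falling a k.+1 = a * falling (a - 1) k.
Proof.
rewrite /falling big_ord_recl subr0; congr (_ * _); apply: eq_bigr => i _.
by rewrite /bump/= natrD opprD addrA.
Qed.

Variables (R : realType) (beta : R).
Hypothesis beta_gtN1 : -1 < beta.

Lemma poch_gt0 k : 0 < poch (beta + 1) k.
Proof.
rewrite prodr_gt0// => i _.
by rewrite ltr_wpDr ?ler0n// -ltrBlDr sub0r.
Qed.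

(** All Pochhammer symbols are nonzero because [beta + 1 > 0], so the quotient
telescopes to the coefficient produced by differentiating a power [k] times. *)
Lemma poch_ratio m k : (k <= m)%N ->
  (poch (beta + 1) m / poch (beta + 1) (m - k))%:C =
  falling (beta%:C + m%:R) k.
Proof.
have -> : beta%:C + m%:R = (beta + m%:R)%:C by rewrite rmorphD/= rmorph_nat.
suff H : (k <= m)%N ->
    poch (beta + 1) m / poch (beta + 1) (m - k) = falling (beta + m%:R) k.
  move=> /H ->; rewrite /falling rmorph_prod; apply: eq_bigr => i _.
  by rewrite rmorphB/= rmorph_nat.
elim: k => [|k IHk] km.
  by rewrite subn0 divff ?gt_eqF ?poch_gt0// /falling big_ord0.
rewrite fallingS -IHk; last exact: ltnW.
have p0 j : poch (beta + 1) j != 0 by rewrite gt_eqF ?poch_gt0.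
have : poch (beta + 1) (m - k) =
    poch (beta + 1) (m - k.+1) * (beta + m%:R - k%:R).
  rewrite -(subnSK km) /poch big_ord_recr/=; congr (_ * _).
  by rewrite -addrA nat1r subnSK// natrB 1?ltnW// addrA.
move=> pE; have := p0 (m - k)%N; rewrite pE mulf_eq0 negb_or => /andP[q0 r0].
by rewrite invfM mulrA divfK.
Qed.

End falling_factorial.

Section elementary_chains.
Variable R : realType.
Implicit Types (z a c : R[i]).

Lemma near_off_cut_stable : nbhs_stable (fun z : R[i] => off_cut z).
Proof. by move=> z; exact: near_off_cut. Qed.

Lemma Cpow_chain a : derivative_chain (fun z : R[i] => off_cut z)
  (fun k z => falling a k * Cpow z (a - k%:R)).
Proof.
move=> k z z0; rewrite fallingS -mulrA -natr1 opprD addrA.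
by apply: is_derive_mulcl; exact: is_derive_Cpow.
Qed.

Lemma CexpN_chain c : derivative_chain (fun=> True)
  (fun k z => (- c) ^+ k * Cexp (- (c * z))).
Proof.
move=> k z _; rewrite exprSr -mulrA; apply: is_derive_mulcl.
have cD : is_derive (z : R[i]^o) 1 (fun w : R[i]^o => - c * w : R[i]^o) (- c).
  by have := is_derive_mulcl (- c) (is_derive_id (z : R[i]^o) 1); rewrite mulr1.
have := @is_derive_compK _ (@Cexp R) (fun w => - c * w) z _ _
  (is_derive_Cexp (- c * z)) cD.
rewrite mulNr [- c * _]mulrC (_ : _ \o _ = (fun w => Cexp (- (c * w))))//.
by apply/funext => w /=; rewrite mulNr.
Qed.

Lemma expr_chain n : derivative_chain (fun=> True)
  (fun k (z : R[i]) => (n ^_ k)%:R * z ^+ (n - k)).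
Proof.
move=> k z _; rewrite ffactnSr natrM -mulrA subnS.
by apply: is_derive_mulcl; exact: is_derive_expr.
Qed.

End elementary_chains.

Lemma derivative_chain_sub (R : realType) (U V : R[i] -> Prop)
    (f : nat -> R[i] -> R[i]) :
  (forall z, U z -> V z) -> derivative_chain V f -> derivative_chain U f.
Proof. by move=> UV fD k z /UV; exact: fD. Qed.

(** * Weighted sums of the terms of the polynomials *)

Lemma mulr_expr_pred (K : comPzRingType) (x : K) n :
  x * (n%:R * x ^+ n.-1) = n%:R * x ^+ n.
Proof. by case: n => [|n]; rewrite ?mul0r ?mulr0// mulrCA exprS. Qed.

Lemma factS_inv (K : numFieldType) n :
  ((n.+1)`!%:R : K)^-1 * n.+1%:R = n`!%:R^-1.
Proof. by rewrite factS natrM invfM mulrAC mulVf ?mul1r// pnatr_eq0. Qed.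

Lemma mulrCA3 (K : comPzRingType) (a b c d : K) :
  a * (b * c * d) = b * (a * c * d).
Proof. by rewrite -!mulrA mulrCA. Qed.

Section Z_polynomials.
Variables (R : realType) (beta : R).
Hypothesis beta_gtN1 : -1 < beta.
Implicit Types (m n k : nat) (z : R[i]).

(** The summands of [n! * Z_(m,n)] are eigenvectors of both Euler operators:
of [delta1] for [m - k] and of [delta2] for [n - k]. *)
Definition Zterm m n z1 z2 k : R[i] :=
  'C(n, k)%:R * falling (beta%:C + m%:R) k * (-1) ^+ (n - k)
    * z1 ^+ (m - k) * z2 ^+ (n - k).

Lemma ZsumE m n z1 z2 : (n <= m)%N ->
  Zsum beta m n z1 z2 = n`!%:R^-1 * \sum_(k < n.+1) Zterm m n z1 z2 k.
Proof.
move=> nm; congr (_ * _); apply: eq_bigr => k _.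
by rewrite poch_ratio// (leq_trans _ nm)// -ltnS.
Qed.

Lemma ZE m n z1 z2 : (n <= m)%N -> Z beta m%:Z n%:Z z1 z2 = Zsum beta m n z1 z2.
Proof. by move=> nm; rewrite /Z nm. Qed.

Lemma Z_predr m n z1 z2 : (n <= m)%N ->
  Z beta m%:Z (n.+1%:Z - 1) z1 z2 = Zsum beta m n z1 z2.
Proof. by move=> nm; rewrite -addn1 PoszD addrK ZE. Qed.

Lemma delta1_Zsum m n z1 z2 : (n <= m)%N ->
  Cdiff (fun w => Zsum beta m n w z2) z1 /\
  z1 * Cderive (fun w => Zsum beta m n w z2) z1 =
    n`!%:R^-1 * \sum_(k < n.+1) (m - k)%:R * Zterm m n z1 z2 k.
Proof.
move=> nm.
pose c k : R[i] := 'C(n, k)%:R * falling (beta%:C + m%:R) k * (-1) ^+ (n - k).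
have ZD : is_derive (z1 : R[i]^o) 1
    ((fun w => Zsum beta m n w z2) : R[i]^o -> R[i]^o)
    (n`!%:R^-1 * \sum_(k < n.+1)
      c k * ((m - k)%:R * z1 ^+ (m - k).-1) * z2 ^+ (n - k)).
  rewrite (_ : (fun w => _) = (fun w => n`!%:R^-1 *
      \sum_(k < n.+1) c k * w ^+ (m - k) * z2 ^+ (n - k))); last first.
    by apply/funext => w; rewrite ZsumE.
  apply: is_derive_mulcl; apply: is_derive_bigsum => k.
  by apply: is_derive_mulcr; apply: is_derive_mulcl; exact: is_derive_expr.
split; first exact: Cdiff_is_derive ZD.
rewrite (Cderive_val ZD) mulrCA mulr_sumr; congr (_ * _); apply: eq_bigr => k _.
transitivity (c k * (z1 * ((m - k)%:R * z1 ^+ (m - k).-1)) * z2 ^+ (n - k)).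
  by ring.
by rewrite mulr_expr_pred /Zterm -/(c k); ring.
Qed.

Lemma delta2_Zsum m n z1 z2 : (n <= m)%N ->
  Cdiff (fun w => Zsum beta m n z1 w) z2 /\
  z2 * Cderive (fun w => Zsum beta m n z1 w) z2 =
    n`!%:R^-1 * \sum_(k < n.+1) (n - k)%:R * Zterm m n z1 z2 k.
Proof.
move=> nm.
pose c k : R[i] := 'C(n, k)%:R * falling (beta%:C + m%:R) k * (-1) ^+ (n - k)
  * z1 ^+ (m - k).
have ZD : is_derive (z2 : R[i]^o) 1
    ((fun w => Zsum beta m n z1 w) : R[i]^o -> R[i]^o)
    (n`!%:R^-1 * \sum_(k < n.+1)
      c k * ((n - k)%:R * z2 ^+ (n - k).-1)).
  rewrite (_ : (fun w => _) = (fun w => n`!%:R^-1 *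
      \sum_(k < n.+1) c k * w ^+ (n - k))); last first.
    by apply/funext => w; rewrite ZsumE.
  apply: is_derive_mulcl; apply: is_derive_bigsum => k.
  by apply: is_derive_mulcl; exact: is_derive_expr.
split; first exact: Cdiff_is_derive ZD.
rewrite (Cderive_val ZD) mulrCA mulr_sumr; congr (_ * _); apply: eq_bigr => k _.
by rewrite mulrCA mulr_expr_pred /Zterm -/(c k); ring.
Qed.

(** Absorbing the eigenvalue by [(n - k) C(n, k) = n C(n - 1, k)] lowers the
second index. *)
Lemma sum_subn_Zterm m n z1 z2 : (n <= m)%N ->
  n`!%:R^-1 * \sum_(k < n.+1) (n - k)%:R * Zterm m n z1 z2 k =
  - z2 * Z beta m%:Z (n%:Z - 1) z1 z2.
Proof.
case: n => [|n] nm.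
  by rewrite big_ord_recl big_ord0 subnn mul0r addr0 !mulr0.
rewrite Z_predr 1?ltnW// ZsumE 1?ltnW// big_ord_recr/= subnn mul0r addr0.
rewrite -(factS_inv _ n) mulrCA3; congr (_ * _); rewrite mulr_sumr.
apply: eq_bigr => k _; have kn : (k <= n)%N by rewrite -ltnS.
have : (n.+1%:R * 'C(n, k)%:R : R[i]) = (n.+1 - k)%:R * 'C(n.+1, k)%:R.
  by rewrite -!natrM (mul_bin_down n.+1).
rewrite /Zterm subSn// !exprS => binE; rewrite !mulrA -binE; ring.
Qed.

(** Absorbing the factor by [k C(n, k) = n C(n - 1, k - 1)] and shifting [k]
lowers both indices; the first factor [beta + m] of the falling factorial comes
out. *)
Lemma sum_ord_Zterm m n z1 z2 : (n <= m)%N ->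
  n`!%:R^-1 * \sum_(k < n.+1) k%:R * Zterm m n z1 z2 k =
  (beta%:C + m%:R) * Z beta (m%:Z - 1) (n%:Z - 1) z1 z2.
Proof.
case: n => [|n] nm.
  rewrite big_ord_recl big_ord0 mul0r addr0 mulr0.
  by case: m nm => [|m] _; rewrite /= ?mulr0// -addn1 PoszD addrK mulr0.
case: m nm => // m nm; rewrite -[in m.+1%:Z]addn1 PoszD addrK Z_predr//.
rewrite ZsumE// big_ord_recl mul0r add0r.
rewrite -(factS_inv _ n) mulrCA3; congr (_ * _); rewrite mulr_sumr.
apply: eq_bigr => k _; rewrite lift0.
have : (n.+1%:R * 'C(n, k)%:R : R[i]) = k.+1%:R * 'C(n.+1, k.+1)%:R.
  by rewrite -!natrM mul_bin_diag.
have aE : beta%:C + m.+1%:R - 1 = beta%:C + m%:R :> R[i].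
  by rewrite -natr1 addrA addrK.
rewrite /Zterm falling_recl aE !subSS => binE.
by rewrite !mulrA -binE; ring.
Qed.

End Z_polynomials.

Section differential_relations.
Variables (R : realType) (beta : R).
Hypothesis beta_gtN1 : -1 < beta.
Variables (m n : nat) (nm : (n <= m)%N) (z1 z2 : R[i]).

Lemma delta2_degree : delta2 (Zsum beta m n) z1 z2 =
  n%:R * Zsum beta m n z1 z2
    - (beta%:C + m%:R) * Z beta (m%:Z - 1) (n%:Z - 1) z1 z2.
Proof.
rewrite /delta2 /pd2 (delta2_Zsum beta_gtN1 z1 z2 nm).2 ZsumE//.
rewrite -(sum_ord_Zterm beta_gtN1 z1 z2 nm) mulrCA -mulrBr; congr (_ * _).
rewrite mulr_sumr -sumrB; apply: eq_bigr => k _.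
by rewrite natrB -1?ltnS// mulrBl.
Qed.

(** [Z_(m,n)] is homogeneous for [delta1 - delta2]: each of its monomials
has degrees that differ by [m - n]. *)
Lemma delta1_degree : delta1 (Zsum beta m n) z1 z2 =
  (m%:R - n%:R) * Zsum beta m n z1 z2 + delta2 (Zsum beta m n) z1 z2.
Proof.
rewrite /delta1 /delta2 /pd1 /pd2 (delta1_Zsum beta_gtN1 z1 z2 nm).2.
rewrite (delta2_Zsum beta_gtN1 z1 z2 nm).2 ZsumE//.
rewrite mulrCA -mulrDr; congr (_ * _); rewrite mulr_sumr -big_split/=.
apply: eq_bigr => k _; have kn : (k <= n)%N by rewrite -ltnS.
by rewrite !natrB// ?(leq_trans kn)// -mulrDl addrA subrK.
Qed.

End differential_relations.

(** * Operational and Rodrigues representations *)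

Lemma cvg_series_finite (K : numFieldType) (V : normedModType K) (u : V^nat) n :
  (forall k, (n <= k)%N -> u k = 0) -> series u @ \oo --> \sum_(k < n) u k.
Proof.
move=> u0; apply: cvg_near_cst; near=> N.
have nN : (n <= N)%N by near: N; exact: nbhs_infty_ge.
rewrite seriesEnat/= (big_cat_nat (leq0n n) nN)//= [X in _ + X]big_nat_cond.
rewrite [X in _ + X]big1 ?addr0 ?big_mkord// => i /andP[/andP[ni _] _].
exact: u0.
Unshelve. all: by end_near. Qed.

Section representations.
Variables (R : realType) (beta : R).
Hypothesis beta_gtN1 : -1 < beta.
Implicit Types (m n k : nat) (z a c : R[i]).

Lemma Cpow_cancel z m k : z != 0 -> (k <= m)%N ->
  Cpow z (- beta)%:C * Cpow z (beta%:C + m%:R - k%:R) = z ^+ (m - k).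
Proof.
move=> z0 km; rewrite -CpowD -Cpow_nat// natrB// rmorphN; congr Cpow.
by rewrite /=; ring.
Qed.

Lemma iter_pd12_Cpow_expr a n z1 z2 : off_cut z1 ->
  let F := fun w1 w2 : R[i] => Cpow w1 a * w2 ^+ n in
  forall k,
  [/\ pd2_exists k F z1 z2, pd1_exists k (iter k (@pd2 R) F) z1 z2 &
      iter k (@pd1 R) (iter k (@pd2 R) F) z1 z2 =
      (n ^_ k)%:R * z2 ^+ (n - k) * (falling a k * Cpow z1 (a - k%:R))].
Proof.
move=> z10 F k.
have F2 w : (forall j z, iter j (@pd2 R) F w z =
    Cpow w a * ((n ^_ j)%:R * z ^+ (n - j))) /\ forall j z, pd2_exists j F w z.
  apply: (iter_pd2_chain (scale_chain (Cpow w a) (expr_chain (R := R) n))) => z.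
  by rewrite ffactn0 mul1r subn0.
have [F1 F1_exists] : (forall j, iter j (@pd1 R) (iter k (@pd2 R) F) z1 z2 =
    (n ^_ k)%:R * z2 ^+ (n - k) * (falling a j * Cpow z1 (a - j%:R))) /\
    forall j, pd1_exists j (iter k (@pd2 R) F) z1 z2.
  apply: (iter_pd1_chain (@near_off_cut_stable R)
    (scale_chain ((n ^_ k)%:R * z2 ^+ (n - k)) (Cpow_chain a))) => // w _.
  by rewrite (F2 w).1 /falling big_ord0 mul1r subr0 mulrC.
by split; [exact: (F2 z1).2 | exact: F1_exists | exact: F1].
Qed.

(** Up to the common factor [(-1)^n z1^beta], the [k]-th term of the
exponential series is the [k]-th term of the defining sum; the terms with
[k > n] vanish because [k] derivatives kill [z2^n]. *)
Lemma operational m n z1 z2 : (n <= m)%N -> off_cut z1 ->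
  let F := fun w1 w2 : R[i] => Cpow w1 (beta + m%:R)%:C * w2 ^+ n in
  expNd12_exists F z1 z2 /\
  Zsum beta m n z1 z2
    = (-1) ^+ n / n`!%:R * Cpow z1 (- beta)%:C * expNd12 F z1 z2.
Proof.
move=> nm z10 F; pose a : R[i] := beta%:C + m%:R.
have aE : (beta + m%:R)%:C = a by rewrite rmorphD/= rmorph_nat.
have := iter_pd12_Cpow_expr a n z2 z10; rewrite -aE -/F aE => Fk.
have tE k : expNd12_term F z1 z2 k = (-1) ^+ k / k`!%:R *
    ((n ^_ k)%:R * z2 ^+ (n - k) * (falling a k * Cpow z1 (a - k%:R))).
  by rewrite /expNd12_term; have [_ _ ->] := Fk k.
have Fcvg : series (expNd12_term F z1 z2) @ \oo -->
    \sum_(k < n.+1) expNd12_term F z1 z2 k.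
  apply: cvg_series_finite => k nk.
  by rewrite tE ffact_small// !mul0r mulr0.
split.
  split; last exact: cvgP Fcvg.
  by move=> k; have [] := Fk k.
rewrite ZsumE// /expNd12 (cvg_lim _ Fcvg)//; set q := Cpow z1 _.
rewrite [_ / n`!%:R]mulrC -2!mulrA; congr (_ * _).
rewrite mulrCA !mulr_sumr; apply: eq_bigr => k _.
have kn : (k <= n)%N by rewrite -ltnS.
rewrite tE /Zterm -/a.
rewrite -(Cpow_cancel (off_cut_neq0 z10) (leq_trans kn nm)) -/a -/q.
have sE : (-1) ^+ n = (-1) ^+ (n - k) * (-1) ^+ k :> R[i].
  by rewrite -exprD subnK.
have s1 : (-1) ^+ k * (-1) ^+ k = 1 :> R[i] by rewrite -expr2 sqrr_sign.
rewrite -bin_ffact natrM sE; set p := Cpow z1 (a - _).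
have k0 : k`!%:R != 0 :> R[i] by rewrite pnatr_eq0 -lt0n fact_gt0.
rewrite -[LHS]mulr1 -[X in _ * X = _]s1; field; exact: k0.
Qed.

(** The [n]-th derivative of [z^a e^(-cz)] as given by Leibniz' formula. *)
Definition Cpow_exp_derive a c n z : R[i] :=
  \sum_(k < n.+1) 'C(n, k)%:R * (falling a k * Cpow z (a - k%:R)
    * ((- c) ^+ (n - k) * Cexp (- (c * z)))).

Lemma Cpow_exp_chain a c :
  derivative_chain (fun z : R[i] => off_cut z) (Cpow_exp_derive a c).
Proof.
exact: (Leibniz_chain (Cpow_chain a)
  (@derivative_chain_sub _ _ (fun=> True) _ (fun _ _ => I) (CexpN_chain c))).
Qed.

Lemma Cpow_exp_derive0 a c z :
  Cpow_exp_derive a c 0 z = Cpow z a * Cexp (- (c * z)).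
Proof.
by rewrite /Cpow_exp_derive big_ord1 /falling big_ord0 bin0 !mul1r subr0.
Qed.

(** Leibniz' formula for [z1^(beta + m) e^(-z1 z2)], with the exponential and
[z1^beta] divided out, is the defining sum of [Z_(m,n)] term by term. *)
Lemma Zsum_Cpow_exp m n z1 z2 : (n <= m)%N -> off_cut z1 ->
  Zsum beta m n z1 z2 = n`!%:R^-1 * Cpow z1 (- beta)%:C * Cexp (z1 * z2)
    * Cpow_exp_derive (beta%:C + m%:R) z2 n z1.
Proof.
move=> nm z10; rewrite ZsumE// -2!mulrA; congr (_ * _).
rewrite mulrA mulr_sumr; apply: eq_bigr => k _.
have kn : (k <= n)%N by rewrite -ltnS.
rewrite /Zterm -(Cpow_cancel (off_cut_neq0 z10) (leq_trans kn nm)).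
rewrite [(- z2) ^+ _]exprNn.
have := CexpN_mulr (z1 * z2); rewrite [in - (z1 * z2)]mulrC => e1.
rewrite -[LHS]mulr1 -[X in _ * X = _]e1; ring.
Qed.

Lemma Rodrigues m n z1 z2 : (n <= m)%N -> off_cut z1 ->
  let G := fun w1 w2 : R[i] => Cpow w1 (m%:R + beta)%:C * Cexp (- (w1 * w2)) in
  pd1_exists n G z1 z2 /\
  Zsum beta m n z1 z2 = n`!%:R^-1 * Cpow z1 (- beta)%:C * Cexp (z1 * z2)
    * iter n (@pd1 R) G z1 z2.
Proof.
move=> nm z10 G.
have [GE G_exists] : (forall k, iter k (@pd1 R) G z1 z2 =
    Cpow_exp_derive (beta%:C + m%:R) z2 k z1) /\ forall k, pd1_exists k G z1 z2.
  apply: (iter_pd1_chain (@near_off_cut_stable R) (Cpow_exp_chain _ _))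
    => // w _.
  by rewrite Cpow_exp_derive0 /G addrC rmorphD/= rmorph_nat [z2 * w]mulrC.
by split; [exact: G_exists | rewrite GE; exact: Zsum_Cpow_exp].
Qed.

(** As [d^m/dz2^m e^(-z1 z2) = (-z1)^m e^(-z1 z2)] and
[z1^beta z1^m = z1^(beta + m)] off the cut, this is the first Rodrigues formula
up to the constant [(-1)^m z2^beta]. *)
Lemma Rodrigues2 m n z1 z2 : (n <= m)%N -> off_cut z1 ->
  let E := fun w1 w2 : R[i] => Cexp (- (w1 * w2)) in
  let H := fun w1 w2 : R[i] =>
    (Cpow w1 beta%:C * Cpow w2 beta%:C) * iter m (@pd2 R) E w1 w2 in
  (pd2_exists m E z1 z2 /\ pd1_exists n H z1 z2) /\
  Zsum beta m n z1 z2
    = (-1) ^+ m / n`!%:R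
      * (Cpow z1 (- beta)%:C * Cpow z2 (- beta)%:C) * Cexp (z1 * z2)
      * iter n (@pd1 R) H z1 z2.
Proof.
move=> nm z10 E H.
have EE w : (forall k z, iter k (@pd2 R) E w z =
    (- w) ^+ k * Cexp (- (w * z))) /\
    forall k z, pd2_exists k E w z.
  by apply: (iter_pd2_chain (CexpN_chain w)) => z; rewrite mul1r.
have [HE H_exists] : (forall k, iter k (@pd1 R) H z1 z2 =
    (-1) ^+ m * Cpow z2 beta%:C * Cpow_exp_derive (beta%:C + m%:R) z2 k z1) /\
    forall k, pd1_exists k H z1 z2.
  apply: (iter_pd1_chain (@near_off_cut_stable R)
    (scale_chain ((-1) ^+ m * Cpow z2 beta%:C) (Cpow_exp_chain _ _)))
    => // w w0.
  rewrite Cpow_exp_derive0 /H (EE w).1 [(- w) ^+ m]exprNn CpowD.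
  rewrite (Cpow_nat _ (off_cut_neq0 w0)).
  by rewrite [z2 * w]mulrC; ring.
split; first by split; [exact: (EE z1).2 | exact: H_exists].
rewrite HE Zsum_Cpow_exp//; set D := Cpow_exp_derive _ _ _ _.
have s1 : (-1) ^+ m * (-1) ^+ m = 1 :> R[i] by rewrite -expr2 sqrr_sign.
have p1 : Cpow z2 (- beta)%:C * Cpow z2 beta%:C = 1.
  by rewrite rmorphN CpowN_mul.
rewrite -[LHS]mulr1 -[X in _ * X = _]s1 -[LHS]mulr1 -[X in _ * X = _]p1; ring.
Qed.

End representations.

Theorem theorem3p2 (R : realType) (beta : R) (hbeta : -1 < beta)
    (m n : nat) (hmn : (n <= m)%N) :
  let Zmn := Z beta m%:Z n%:Z in
  let Zmn1 := Z beta m%:Z (n%:Z - 1) in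
  let Zm1n1 := Z beta (m%:Z - 1) (n%:Z - 1) in
  [/\
      forall z1 z2 : R[i],
        (pd1_exists 1 Zmn z1 z2 /\ pd2_exists 1 Zmn z1 z2) /\
        [/\ delta2 Zmn z1 z2 = - z2 * Zmn1 z1 z2,
            delta2 Zmn z1 z2
              = n%:R * Zmn z1 z2 - (beta + m%:R)%:C * Zm1n1 z1 z2,
            delta1 Zmn z1 z2 = (m%:R - n%:R) * Zmn z1 z2 - z2 * Zmn1 z1 z2 &
            delta1 Zmn z1 z2
              = m%:R * Zmn z1 z2 - (m%:R + beta)%:C * Zm1n1 z1 z2] /\
        delta1 Zmn z1 z2 - delta2 Zmn z1 z2 = (m%:R - n%:R) * Zmn z1 z2 /\
        n%:R * delta1 Zmn z1 z2 - m%:R * delta2 Zmn z1 z2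
          = (m%:R - n%:R) * (m%:R + beta)%:C * Zm1n1 z1 z2,
      forall z1 z2 : R[i], off_cut z1 ->
        let F := fun w1 w2 : R[i] => Cpow w1 (beta + m%:R)%:C * w2 ^+ n in
        expNd12_exists F z1 z2 /\
        Zmn z1 z2
          = (-1) ^+ n / n`!%:R * Cpow z1 (- beta)%:C * expNd12 F z1 z2,
      forall z1 z2 : R[i], off_cut z1 ->
        let G := fun w1 w2 : R[i] =>
          Cpow w1 (m%:R + beta)%:C * Cexp (- (w1 * w2)) in
        pd1_exists n G z1 z2 /\
        Zmn z1 z2
          = (n`!%:R)^-1 * Cpow z1 (- beta)%:C * Cexp (z1 * z2)
            * iter n (@pd1 R) G z1 z2 &
      forall z1 z2 : R[i], off_cut z1 -> off_cut z2 ->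
        let E := fun w1 w2 : R[i] => Cexp (- (w1 * w2)) in
        let H := fun w1 w2 : R[i] =>
          (Cpow w1 beta%:C * Cpow w2 beta%:C) * iter m (@pd2 R) E w1 w2 in
        (pd2_exists m E z1 z2 /\ pd1_exists n H z1 z2) /\
        Zmn z1 z2
          = (-1) ^+ m / n`!%:R
            * (Cpow z1 (- beta)%:C * Cpow z2 (- beta)%:C) * Cexp (z1 * z2)
            * iter n (@pd1 R) H z1 z2].
Proof.
move=> Zmn Zmn1 Zm1n1.
have ZmnE : Zmn = Zsum beta m n.
  by apply/funext => z1; apply/funext => z2; rewrite /Zmn ZE.
have CE x : (x + m%:R)%:C = x%:C + m%:R :> R[i].
  by rewrite rmorphD/= rmorph_nat.
rewrite ZmnE; split.
- move=> z1 z2.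
  have D2Z' := delta2_degree hbeta hmn z1 z2.
  have D1D2 := delta1_degree hbeta hmn z1 z2.
  have D2Z : delta2 (Zsum beta m n) z1 z2 = - z2 * Zmn1 z1 z2.
    rewrite /delta2 /pd2 (delta2_Zsum hbeta z1 z2 hmn).2.
    exact: sum_subn_Zterm.
  split.
    split=> -[|//] _.
      exact: (delta1_Zsum hbeta z1 z2 hmn).1.
    exact: (delta2_Zsum hbeta z1 z2 hmn).1.
  rewrite -[Z beta _ _]/Zm1n1 in D2Z'.
  rewrite [m%:R + beta]addrC CE; split; first split.
  + exact: D2Z.
  + exact: D2Z'.
  + by rewrite D1D2 D2Z mulNr.
  + by rewrite D1D2 D2Z'; ring.
  + by split; [rewrite D1D2 | rewrite D1D2 D2Z']; ring.
- by move=> z1 z2 z10; exact: operational.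
- by move=> z1 z2 z10; exact: Rodrigues.
- by move=> z1 z2 z10 _; exact: Rodrigues2.
Qed.
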